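(* Consider the system $$x(k+1)=A_0x(k)+A_1x(k-h_1(k))+Bu(k-h_2(k)),\qquad k\in\mathbb{Z}_{\ge0},\qquad(\ast)$$ with $x(k)\in\mathbb{R}^n$, $u(k)\in\mathbb{R}^m$, and unknown constant real matrices $A_0,A_1,B$, and let the data matrices $U_{h_2,\{0\}},X_{h_1,\{0\}},X_{\{0\}},X_{\{1\}},W_0$ be as defined in the context. Suppose that $\mathrm{rank}(W_0)=m+2n$. Given a positive (integer) delay bound $\bar h$ and a tuning parameter $\varepsilon>0$, let there exist $n\times n$ matrices $\bar P>0$, $\bar S>0$, $\bar R_i>0$, $\bar S_{12,i}$, $i\in\{1,2\}$, and $T\times n$ matrices $Q_1,Q_2,Q_3$ such that $$\bar{\mathbf{\Phi}}>0,\qquad \begin{bmatrix}\bar R_i & \bar S_{12,i}\\ \star & \bar R_i\end{bmatrix}\ge0,\quad i\in\{1,2\},$$ with the matrix $\bar{\mathbf{\Phi}}$ given in the context, and $$\begin{aligned}U_{h_2,\{0\}}Q_2&=U_{h_2,\{0\}}Q_3=0,\\ X_{h_1,\{0\}}Q_1&=X_{h_1,\{0\}}Q_3=0,\\ X_{\{0\}}Q_1&=X_{\{0\}}Q_2=0,\\ X_{h_1,\{0\}}Q_2&=X_{\{0\}}Q_3.\end{aligned}$$ Choose the feedback gain as $$K=U_{h_2,\{0\}}Q_1\big(X_{\{0\}}Q_3\big)^{-1}.$$ Then for all delays $h_1(k)\in[0,\bar h]$ and $h_2(k)\in[0,\bar h]$ for all $k\in\mathbb{Z}_{\ge0}$,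 the origin of $(\ast)$ in closed loop with the control $u(k)=Kx(k)$ is asymptotically stable.
   Context: Closed loop: $x(k+1)=A_0x(k)+A_1x(k-h_1(k))+BKx(k-h_2(k))$, where $h_1(k),h_2(k)$ are integer-valued, possibly time-varying, uncertain delays; initial conditions are histories $x(j)$, $j\in\mathbb{Z}\cap[-\bar h,0]$. Recorded data: sequences $u(k)\in\mathbb{R}^m$, $x(k)\in\mathbb{R}^n$, $k=-\bar h,\dots,T$, with $T>\bar h$, are available, satisfying $x(k+1)=A_0x(k)+A_1x(k-h_1)+Bu(k-h_2)$ for $k=0,\dots,T-1$ with constant known delays $h_1,h_2\in\{0,\dots,\bar h\}$ (the delays are constant while the data are recorded, though they may vary in closed-loop operation). Set $U_{h_2,\{0\}}=[u(-h_2)\ \cdots\ u(T-1-h_2)]$, $X_{h_1,\{0\}}=[x(-h_1)\ \cdots\ x(T-1-h_1)]$, $X_{\{0\}}=[x(0)\ \cdots\ x(T-1)]$, $X_{\{1\}}=[x(1)\ \cdots\ x(T)]$, and $W_0=\begin{bmatrix}U_{h_2,\{0\}}\\ X_{h_1,\{0\}}\\ X_{\{0\}}\end{bmatrix}\in\mathbb{R}^{(m+2n)\times T}$. $M>0$ means $M$ is symmetric positive definite; $\star$ denotes entries below the diagonal determined by symmetry. The symmetric $5n\times5n$ matrix $\bar{\mathbf{\Phi}}$ is $$\bar{\mathbf{\Phi}}=\begin{bmatrix} \bar{\mathbf{\Phi}}_{11} & \bar{\mathbf{\Phi}}_{12} & \bar{\mathbf{\Phi}}_{13} & -\bar S_{12,1}-\bar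 S_{12,2} & \bar{\mathbf{\Phi}}_{15}\\ \star & 2\bar R_1-\bar S_{12,1}-\bar S_{12,1}^\top & 0 & -\bar R_1+\bar S_{12,1} & -\varepsilon(X_{\{1\}}Q_2)^\top\\ \star & \star & 2\bar R_2-\bar S_{12,2}-\bar S_{12,2}^\top & -\bar R_2+\bar S_{12,2} & -\varepsilon(X_{\{1\}}Q_1)^\top\\ \star & \star & \star & \bar R_1+\bar R_2+\bar S & 0\\ \star & \star & \star & \star & \bar{\mathbf{\Phi}}_{55}\end{bmatrix},$$ with $\bar{\mathbf{\Phi}}_{11}=\bar P-\bar S+(1-\bar h^2)(\bar R_1+\bar R_2)-X_{\{1\}}Q_3-(X_{\{1\}}Q_3)^\top$, $\bar{\mathbf{\Phi}}_{12}=-\bar R_1+\bar S_{12,1}-X_{\{1\}}Q_2$, $\bar{\mathbf{\Phi}}_{13}=-\bar R_2+\bar S_{12,2}-X_{\{1\}}Q_1$, $\bar{\mathbf{\Phi}}_{15}=\bar h^2(\bar R_1+\bar R_2)+X_{\{0\}}Q_3-\varepsilon(X_{\{1\}}Q_3)^\top$, $\bar{\mathbf{\Phi}}_{55}=-\bar P-\bar h^2(\bar R_1+\bar R_2)+\varepsilon(X_{\{0\}}Q_3+Q_3^\top X_{\{0\}}^\top)$. (The condition $\bar{\mathbf{\Phi}}>0$ implies that $X_{\{0\}}Q_3$ is nonsingular, so $K$ is well defined.) *)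

(* Defs.v *)
From mathcomp Require Import all_boot all_order all_algebra.
From mathcomp Require Import all_classical all_reals all_analysis.

Set Implicit Arguments.
Unset Strict Implicit.
Unset Printing Implicit Defensive.

Import Order.TTheory GRing.Theory Num.Theory.
Import numFieldNormedType.Exports.
Local Open Scope classical_set_scope.
Local Open Scope ring_scope.

Section Definiteness.
Context {R : realType}.

Definition posdef (p : nat) (M : 'M[R]_p) : Prop :=
  M^T = M /\ forall v : 'cV[R]_p, v != 0 -> 0 < (v^T *m M *m v) 0 0.

Definition possemidef (p : nat) (M : 'M[R]_p) : Prop :=
  M^T = M /\ forall v : 'cV[R]_p, 0 <= (v^T *m M *m v) 0 0.

(* [ A B ; * D ], with the entry * given by symmetry. *)
Definition sym_block_mx (p q : nat)
    (A : 'M[R]_p) (B : 'M[R]_(p, q)) (D : 'M[R]_q) : 'M[R]_(p + q) :=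
  block_mx A B B^T D.

End Definiteness.

Section DelaySystem.
Context {R : realType} {n m : nat}.

(* Signals are indexed by [int] so that histories at negative times make
   sense; values at times before the start of the history play no role. *)
Definition delay_step (A0 A1 : 'M[R]_n) (B : 'M[R]_(n, m)) (h1 h2 : nat)
    (u : int -> 'cV[R]_m) (x : int -> 'cV[R]_n) (k : nat) : Prop :=
  x (k%:Z + 1) = A0 *m x k%:Z + A1 *m x (k%:Z - h1%:Z)
                 + B *m u (k%:Z - h2%:Z).

Definition closed_loop (A0 A1 : 'M[R]_n) (B : 'M[R]_(n, m)) (K : 'M[R]_(m, n))
    (h1 h2 : nat -> nat) (x : int -> 'cV[R]_n) : Prop :=
  forall k : nat, delay_step A0 A1 B (h1 k) (h2 k) (fun j => K *m x j) x k.

End DelaySystem.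

Section Stability.
Context {R : realType} {n : nat}.

(* The history of [x] on [-hbar, 0] has sup-norm less than [d]. *)
Definition history_lt (hbar : nat) (d : R) (x : int -> 'cV[R]_n) : Prop :=
  forall j : int, - hbar%:Z <= j <= 0 -> `|x j| < d.

(* Lyapunov stability and attractivity of the origin, for a system given by
   its set of trajectories. *)
Definition asymptotically_stable (hbar : nat)
    (sol : (int -> 'cV[R]_n) -> Prop) : Prop :=
  (forall e : R, 0 < e -> exists2 d : R, 0 < d &
     forall x, sol x -> history_lt hbar d x -> forall k : nat, `|x k%:Z| < e)
  /\
  (exists2 d : R, 0 < d &
     forall x, sol x -> history_lt hbar d x ->
       (fun k : nat => x k%:Z) @ \oo --> (0 : 'cV[R]_n)).

End Stability.

Section Data.
Context {R : realType}.

(* [ z(s)  z(s+1) ... z(s+T-1) ] *)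
Definition data_mx (p : nat) (z : int -> 'cV[R]_p) (s : int) (T : nat) :
    'M[R]_(p, T) :=
  \matrix_(i < p, j < T) z (s + j%:Z) i 0.

Context {n T : nat}.

Definition Phi (hbar : nat) (eps : R) (X0 X1 : 'M[R]_(n, T))
    (P S R1 R2 S12_1 S12_2 : 'M[R]_n) (Q1 Q2 Q3 : 'M[R]_(T, n)) :
    'M[R]_(n + (n + (n + (n + n)))) :=
  let h2 := hbar%:R ^+ 2 in
  let Phi11 := P - S + (1 - h2) *: (R1 + R2) - X1 *m Q3 - (X1 *m Q3)^T in
  let Phi12 := - R1 + S12_1 - X1 *m Q2 in
  let Phi13 := - R2 + S12_2 - X1 *m Q1 in
  let Phi14 := - S12_1 - S12_2 in
  let Phi15 := h2 *: (R1 + R2) + X0 *m Q3 - eps *: (X1 *m Q3)^T in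
  let Phi22 := 2 *: R1 - S12_1 - S12_1^T in
  let Phi24 := - R1 + S12_1 in
  let Phi25 := - (eps *: (X1 *m Q2)^T) in
  let Phi33 := 2 *: R2 - S12_2 - S12_2^T in
  let Phi34 := - R2 + S12_2 in
  let Phi35 := - (eps *: (X1 *m Q1)^T) in
  let Phi44 := R1 + R2 + S in
  let Phi55 := - P - h2 *: (R1 + R2) + eps *: (X0 *m Q3 + Q3^T *m X0^T) in
  sym_block_mx Phi11 (row_mx Phi12 (row_mx Phi13 (row_mx Phi14 Phi15)))
    (sym_block_mx Phi22 (row_mx 0 (row_mx Phi24 Phi25))
      (sym_block_mx Phi33 (row_mx Phi34 Phi35)
        (sym_block_mx Phi44 0 Phi55))).

End Data.

(* Main.v *)
(* Put Z = X0 Q3, which is invertible because Phi > 0 forces Z + Z^T > 0.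
   The data equation X1 = A0 X0 + A1 Xh + B U and the constraints on the Q_i give
   X1 Q3 = A0 Z, X1 Q2 = A1 Z and X1 Q1 = B K Z, so that y = Z^-1 x obeys
     Z y(k+1) = X1 Q3 y(k) + X1 Q2 y(k-h1) + X1 Q1 y(k-h2).
   With M = R1 + R2 and eta(j) = y(j+1) - y(j), take the functional
     V(k) = y(k)' P y(k) + sum_{k-h <= j < k} y(j)' S y(j)
            + h sum_{k-h <= j < k} (j-k+h+1) eta(j)' M eta(j).
   Jensen's inequality and the reciprocally convex combination bound, together
   with 2 (y(k) + eps y(k+1))' times the dynamics, give
     V(k+1) - V(k) <= - xi' Phi xi,
     xi = (y(k), y(k-h1), y(k-h2), y(k-h), y(k+1)).
   As x(k) is linear in y(k), |x(k)|^2 is dominated both by V(k) (stability)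
   and by V(k) - V(k+1), which tends to 0 (attractivity). *)
Require Import Defs.
From mathcomp Require Import all_boot all_order all_algebra.
From mathcomp Require Import all_classical all_reals all_analysis.
From mathcomp Require Import ring lra zify.

Import Order.TTheory GRing.Theory Num.Theory.
Import numFieldNormedType.Exports.
Local Open Scope ring_scope.

(** * Bilinear forms of real matrices: Cauchy-Schwarz, norm bounds, Jensen-type inequalities *)

Section BilinearForm.
Context {R : realType}.

Definition bform {p q : nat} (M : 'M[R]_(p, q))
    (u : 'cV[R]_p) (v : 'cV[R]_q) : R :=
  (u^T *m M *m v) 0 0.

Lemma bformDl p q (M : 'M[R]_(p, q)) u1 u2 v :
  bform M (u1 + u2) v = bform M u1 v + bform M u2 v.
Proof. by rewrite /bform linearD !mulmxDl mxE. Qed.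

Lemma bformDr p q (M : 'M[R]_(p, q)) u v1 v2 :
  bform M u (v1 + v2) = bform M u v1 + bform M u v2.
Proof. by rewrite /bform mulmxDr mxE. Qed.

Lemma bformNl p q (M : 'M[R]_(p, q)) u v : bform M (- u) v = - bform M u v.
Proof. by rewrite /bform linearN !mulNmx mxE. Qed.

Lemma bformNr p q (M : 'M[R]_(p, q)) u v : bform M u (- v) = - bform M u v.
Proof. by rewrite /bform mulmxN mxE. Qed.

Lemma bformZl p q (M : 'M[R]_(p, q)) a u v : bform M (a *: u) v = a * bform M u v.
Proof. by rewrite /bform linearZ /= -!scalemxAl mxE. Qed.

Lemma bformZr p q (M : 'M[R]_(p, q)) a u v : bform M u (a *: v) = a * bform M u v.
Proof. by rewrite /bform -scalemxAr mxE. Qed.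

Lemma bform0l p q (M : 'M[R]_(p, q)) v : bform M 0 v = 0.
Proof. by rewrite /bform linear0 !mul0mx mxE. Qed.

Lemma bform0r p q (M : 'M[R]_(p, q)) u : bform M u 0 = 0.
Proof. by rewrite /bform mulmx0 mxE. Qed.

Lemma bformDm p q (M N : 'M[R]_(p, q)) u v :
  bform (M + N) u v = bform M u v + bform N u v.
Proof. by rewrite /bform mulmxDr mulmxDl mxE. Qed.

Lemma bformNm p q (M : 'M[R]_(p, q)) u v : bform (- M) u v = - bform M u v.
Proof. by rewrite /bform mulmxN mulNmx mxE. Qed.

Lemma bformZm p q (M : 'M[R]_(p, q)) a u v : bform (a *: M) u v = a * bform M u v.
Proof. by rewrite /bform -scalemxAr -scalemxAl mxE. Qed.

Lemma bform0m p q (u : 'cV[R]_p) (v : 'cV[R]_q) : bform 0 u v = 0.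
Proof. by rewrite /bform mulmx0 mul0mx mxE. Qed.

Lemma bform_trmx p q (M : 'M[R]_(p, q)) u v : bform M^T u v = bform M v u.
Proof.
rewrite /bform; transitivity ((v^T *m M *m u)^T 0 0); last by rewrite mxE.
by rewrite !trmx_mul trmxK mulmxA.
Qed.

Lemma bform_mulmx p q r (M : 'M[R]_(p, q)) (N : 'M[R]_(q, r)) u v :
  bform (M *m N) u v = bform M u (N *m v).
Proof. by rewrite /bform !mulmxA. Qed.

Lemma bform_sym p (M : 'M[R]_p) u v : M^T = M -> bform M u v = bform M v u.
Proof. by move=> Msym; rewrite -{1}Msym bform_trmx. Qed.

Lemma bform_sumr p q (M : 'M[R]_(p, q)) u I (r : seq I) (f : I -> 'cV[R]_q) :
  bform M u (\sum_(i <- r) f i) = \sum_(i <- r) bform M u (f i).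
Proof.
elim: r => [|i r IH]; first by rewrite !big_nil bform0r.
by rewrite !big_cons bformDr IH.
Qed.

Lemma bform_suml p q (M : 'M[R]_(p, q)) v I (r : seq I) (f : I -> 'cV[R]_p) :
  bform M (\sum_(i <- r) f i) v = \sum_(i <- r) bform M (f i) v.
Proof.
elim: r => [|i r IH]; first by rewrite !big_nil bform0l.
by rewrite !big_cons bformDl IH.
Qed.

Lemma bform_row_mx p q1 q2 (M1 : 'M[R]_(p, q1)) (M2 : 'M[R]_(p, q2)) u v1 v2 :
  bform (row_mx M1 M2) u (col_mx v1 v2) = bform M1 u v1 + bform M2 u v2.
Proof. by rewrite /bform mul_mx_row mul_row_col mxE. Qed.

Lemma bform_sym_block_mx p q (A : 'M[R]_p) (B : 'M[R]_(p, q)) (D : 'M[R]_q) u v :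
  bform (sym_block_mx A B D) (col_mx u v) (col_mx u v) =
  bform A u u + 2 * bform B u v + bform D v v.
Proof.
rewrite /bform /sym_block_mx tr_col_mx mul_row_block mul_row_col !mulmxDl.
rewrite 3![fun_of_matrix (_ + _) _ _]mxE.
have -> : (v^T *m B^T *m u) 0 0 = (u^T *m B *m v) 0 0 by exact: bform_trmx.
ring.
Qed.

Lemma cauchy_schwarz_posdef p (M : 'M[R]_p) u v : posdef M ->
  bform M u v ^+ 2 <= bform M u u * bform M v v.
Proof.
case=> Msym Mpos; have [->|u0] := eqVneq u 0.
  by rewrite !bform0l mul0r expr0n.
have a0 : 0 < bform M u u by exact: Mpos.
have : 0 <= bform M (bform M u u *: v - bform M u v *: u)
                    (bform M u u *: v - bform M u v *: u).
  have [->|w0] := eqVneq (bform M u u *: v - bform M u v *: u) 0.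
    by rewrite bform0l.
  exact/ltW/Mpos.
rewrite !(bformDl, bformDr, bformNl, bformNr, bformZl, bformZr).
rewrite (bform_sym _ _ v u Msym).
set a := bform M u u; set b := bform M u v; set c := bform M v v => h.
have {}h : 0 <= a * (a * c - b ^+ 2) by move: h; congr (_ <= _); ring.
by rewrite -subr_ge0 -(pmulr_rge0 _ a0).
Qed.

(** A row vector in the kernel would make the form vanish at its transpose. Symmetry is not assumed,
    so that this applies to [X0 *m Q3]. *)
Lemma unitmx_bform p (M : 'M[R]_p) :
  (forall v, v != 0 -> bform M v v != 0) -> M \in unitmx.
Proof.
move=> h; rewrite unitmxE unitfE; apply/det0P => -[v v0 vM].
have := h v^T; rewrite /bform trmxK vM mul0mx mxE eqxx.
by rewrite trmx_eq0 => /(_ v0).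
Qed.

Lemma posdef_unitmx p (M : 'M[R]_p) : posdef M -> M \in unitmx.
Proof.
by case=> _ h; apply: unitmx_bform => v /h; rewrite lt0r => /andP[].
Qed.

Lemma posdef_ge0 p (M : 'M[R]_p) v : posdef M -> 0 <= bform M v v.
Proof.
case=> _ h; have [->|/h/ltW//] := eqVneq v 0.
by rewrite bform0l.
Qed.

Lemma posdefD p (M N : 'M[R]_p) : posdef M -> posdef N -> posdef (M + N).
Proof.
move=> [Ms Mp] [Ns Np]; split; first by rewrite linearD /= Ms Ns.
move=> v v0; rewrite -[X in 0 < X]/(bform _ v v) bformDm.
by rewrite addr_gt0 ?Mp ?Np.
Qed.

Lemma norm_mx_entry_le p q (A : 'M[R]_(p, q)) i j : `|A i j| <= `|A|.
Proof.
by rewrite {2}/Num.norm /= mx_normrE (le_bigmax _ (fun ij => `|A ij.1 ij.2|) (i, j)).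
Qed.

Lemma norm_mx_attained p q (A : 'M[R]_(p, q)) :
  A = 0 \/ exists i j, `|A| = `|A i j|.
Proof.
have [A0|] := eqVneq `|A| 0; first by left; apply/normr0_eq0.
by move=> /mx_norm_neq0[[i j] /= h]; right; exists i, j.
Qed.

(** Entry [i] of [L *m v] is [bform M (w i) v] with [w i] the image of row [i] of [L] under
    [invmx M], so Cauchy-Schwarz bounds it. The norm is the largest entry; summing over [i] gives
    one constant for all of them, and the summand 1 keeps it positive. *)
Lemma posdef_norm_le p q (M : 'M[R]_p) (L : 'M[R]_(q, p)) : posdef M ->
  exists2 c : R, 0 < c & forall v, `|L *m v| ^+ 2 <= c * bform M v v.
Proof.
move=> Mpos; have Mu := posdef_unitmx _ _ Mpos; have [Msym _] := Mpos.
pose w i := invmx M *m (row i L)^T.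
have w0 i : 0 <= bform M (w i) (w i) by exact: posdef_ge0.
have Lw i v : (L *m v) i 0 = bform M (w i) v.
  rewrite /bform /w trmx_mul trmxK trmx_inv Msym -mulmxA mulmxA mulmxKV //.
  by rewrite -row_mul [RHS]mxE.
pose c := 1 + \sum_i bform M (w i) (w i).
have c0 : 0 < c by rewrite ltr_pwDl ?sumr_ge0.
exists c; first by [].
move=> v; have v0 := posdef_ge0 _ _ v Mpos.
case: (norm_mx_attained _ _ (L *m v)) => [->|[i [j ->]]].
  by rewrite normr0 expr2 mul0r mulr_ge0 ?(ltW c0).
rewrite ord1 Lw -normrX ger0_norm ?sqr_ge0 //.
apply: (le_trans (cauchy_schwarz_posdef _ _ _ _ Mpos)).
apply: ler_wpM2r => //; rewrite /c (bigD1 i) //= addrCA lerDl.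
by rewrite addr_ge0 ?sumr_ge0.
Qed.

Lemma bform_le_norm p (M : 'M[R]_p) :
  exists2 c : R, 0 <= c & forall v d, `|v| < d -> bform M v v <= c * d ^+ 2.
Proof.
exists (\sum_i \sum_j `|M j i|); first by rewrite sumr_ge0// => i _; rewrite sumr_ge0.
move=> v d vd; rewrite /bform mxE mulr_suml ler_sum// => i _.
rewrite mxE !mulr_suml ler_sum// => j _; rewrite mxE.
have h k : `|v k 0| <= d by rewrite (le_trans (norm_mx_entry_le _ _ v k 0)) ?ltW.
apply: (le_trans (ler_norm _)); rewrite !normrM.
have -> : `|v j 0| * `|M j i| * `|v i 0| = `|M j i| * (`|v j 0| * `|v i 0|) by ring.
by rewrite ler_wpM2l // expr2 ler_pM.
Qed.

Lemma sumr_const_seq I (r : seq I) (a : R) : \sum_(i <- r) a = (size r)%:R * a.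
Proof. by rewrite big_const_seq count_predT iter_addr_0 mulr_natl. Qed.

(* [0 <= sum_(i, j in r) |f i - f j|^2], expanded. *)
Lemma bform_jensen p (M : 'M[R]_p) I (r : seq I) (f : I -> 'cV[R]_p) : posdef M ->
  bform M (\sum_(i <- r) f i) (\sum_(i <- r) f i) <=
  (size r)%:R * \sum_(i <- r) bform M (f i) (f i).
Proof.
move=> Mpos; have [Msym _] := Mpos.
have : 0 <= \sum_(i <- r) \sum_(j <- r) bform M (f i - f j) (f i - f j).
  by apply: sumr_ge0 => i _; apply: sumr_ge0 => j _; exact: posdef_ge0.
have -> : \sum_(i <- r) \sum_(j <- r) bform M (f i - f j) (f i - f j) =
  2 * ((size r)%:R * \sum_(i <- r) bform M (f i) (f i) -
       bform M (\sum_(i <- r) f i) (\sum_(i <- r) f i)).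
  under eq_bigr => i _.
    under eq_bigr => j _.
      rewrite (_ : bform M _ _ = bform M (f i) (f i) + bform M (f j) (f j)
        + (- 2) * bform M (f i) (f j)); last first.
        rewrite !(bformDl, bformDr, bformNl, bformNr).
        by rewrite (bform_sym _ _ (f j) (f i) Msym); ring.
      over.
    rewrite !big_split /= sumr_const_seq -mulr_sumr -bform_sumr.
    over.
  rewrite !big_split /= sumr_const_seq -!mulr_sumr -bform_suml; ring.
by rewrite pmulr_rge0 // subr_ge0.
Qed.

(* Division-free form of the reciprocally convex combination bound: the block
   form is nonnegative at every pair [(f i, - f j)] with [i] in [r], [j] in [s]. *)
Lemma bform_reciprocally_convex p (M N : 'M[R]_p) I (r s : seq I) (f : I -> 'cV[R]_p) :
  posdef M -> possemidef (sym_block_mx M N M) ->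
  bform M (\sum_(i <- r) f i) (\sum_(i <- r) f i) +
  2 * bform N (\sum_(i <- r) f i) (\sum_(j <- s) f j) +
  bform M (\sum_(j <- s) f j) (\sum_(j <- s) f j) <=
  (size r + size s)%:R *
  (\sum_(i <- r) bform M (f i) (f i) + \sum_(j <- s) bform M (f j) (f j)).
Proof.
move=> Mpos [_ MNpos].
have ja := bform_jensen _ _ _ r f Mpos; have jb := bform_jensen _ _ _ s f Mpos.
have : 0 <= \sum_(i <- r) \sum_(j <- s)
    (bform M (f i) (f i) + bform M (f j) (f j) + (- 2) * bform N (f i) (f j)).
  apply: sumr_ge0 => i _; apply: sumr_ge0 => j _.
  have := MNpos (col_mx (f i) (- f j)).
  rewrite -[X in 0 <= X]/(bform _ _ _) bform_sym_block_mx.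
  rewrite !(bformNl, bformNr) => h; move: h; congr (_ <= _); ring.
under eq_bigr => i _.
  rewrite !big_split /= sumr_const_seq -mulr_sumr -bform_sumr.
  over.
rewrite !big_split /= sumr_const_seq -!mulr_sumr -bform_suml natrD.
(* With A and B the sums of [bform M (f _) (f _)] over [r] and [s], Jensen contributes |r| A + |s| B
   and the double sum |s| A + |r| B, in total (|r| + |s|)(A + B). *)
lra.
Qed.

End BilinearForm.

(** * The Lyapunov-Krasovskii functional and its decrease along trajectories *)

Section LyapunovKrasovskii.
Context {R : realType} {n : nat}.
Implicit Types (P S M N : 'M[R]_n) (z : nat -> 'cV[R]_n).

(* The time index is shifted by [h]: [z (k + h)] is the current state and
   [z k, ..., z (k + h)] is the history. *)
Definition lyapunov (h : nat) P S M z (k : nat) : R :=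
  bform P (z (k + h)%N) (z (k + h)%N)
  + \sum_(0 <= i < h) bform S (z (k + i)%N) (z (k + i)%N)
  + h%:R * \sum_(0 <= i < h) (i.+1)%:R *
      bform M (z (k + i).+1 - z (k + i)%N) (z (k + i).+1 - z (k + i)%N).

Lemma lyapunov_ge h P S M z k : posdef S -> posdef M ->
  bform P (z (k + h)%N) (z (k + h)%N) <= lyapunov h P S M z k.
Proof.
move=> Spos Mpos; rewrite /lyapunov -addrA lerDl addr_ge0 ?mulr_ge0 //.
  by apply: sumr_ge0 => i _; exact: posdef_ge0.
by apply: sumr_ge0 => i _; rewrite mulr_ge0 ?posdef_ge0.
Qed.

Lemma sum_shift (F : nat -> R) h k :
  \sum_(0 <= i < h) F (k.+1 + i)%N =
  \sum_(0 <= i < h) F (k + i)%N + F (k + h)%N - F k.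
Proof.
elim: h => [|h IH]; first by rewrite !big_nil addn0; ring.
by rewrite !big_nat_recr //= IH addnS addSn; ring.
Qed.

(** When the window moves by one, the new term enters with weight [h] and every old term loses one
    unit of weight; the lost units form the unweighted sum, the negative term of the decrement. *)
Lemma weighted_sum_shift (F : nat -> R) h k :
  \sum_(0 <= i < h) (i.+1)%:R * F (k.+1 + i)%N =
  \sum_(0 <= i < h) (i.+1)%:R * F (k + i)%N + h%:R * F (k + h)%N
  - \sum_(0 <= i < h) F (k + i)%N.
Proof.
elim: h => [|h IH]; first by rewrite !big_nil; ring.
by rewrite !big_nat_recr //= IH addnS addSn -(addn1 h) natrD; ring.
Qed.

Lemma lyapunov_step h P S M z k :
  let dM i := bform M (z i.+1 - z i) (z i.+1 - z i) in
  lyapunov h P S M z k.+1 = lyapunov h P S M z k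
  + (bform P (z (k + h).+1) (z (k + h).+1) - bform P (z (k + h)%N) (z (k + h)%N))
  + (bform S (z (k + h)%N) (z (k + h)%N) - bform S (z k) (z k))
  + h%:R * (h%:R * dM (k + h)%N - \sum_(0 <= i < h) dM (k + i)%N).
Proof.
move=> dM; rewrite /lyapunov (sum_shift (fun i => bform S (z i) (z i))).
rewrite (weighted_sum_shift dM) addSn -/(dM _); ring.
Qed.

(** The delayed instant cuts the window into pieces of lengths [t] and [h - t], on which the
    increments telescope to [y - yt] and [yt - z k]. The lengths add up to [h] for every [t], and an
    empty piece ([t = 0] or [t = h]) is harmless as nothing is divided by a length. *)
Lemma delay_sum_ge h M N z k t : (t <= h)%N ->
  posdef M -> possemidef (sym_block_mx M N M) ->
  let y := z (k + h)%N in let yt := z (k + h - t)%N in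
  bform M (y - yt) (y - yt) + 2 * bform N (y - yt) (yt - z k)
  + bform M (yt - z k) (yt - z k) <=
  h%:R * \sum_(0 <= i < h)
    bform M (z (k + i).+1 - z (k + i)%N) (z (k + i).+1 - z (k + i)%N) :> R.
Proof.
move=> le_th Mpos MN /=.
pose f i := z (k + i).+1 - z (k + i)%N.
have tele a b : (a <= b)%N -> \sum_(a <= i < b) f i = z (k + b)%N - z (k + a)%N.
  move=> ab; rewrite -(telescope_sumr (fun i => z (k + i)%N) ab).
  by apply: eq_bigr => i _; rewrite /f addnS.
have := bform_reciprocally_convex _ _ _ _ (index_iota (h - t) h)
  (index_iota 0 (h - t)) f Mpos MN.
rewrite !tele ?leq_subr // addn0 addnBA // !size_iota subn0 subKn // subnKC //.
by rewrite [X in _ <= _ * X]addrC -big_cat_nat //= leq_subr.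
Qed.

(** All terms of [Phi] containing some [Q] add up to 2 (y + eps y')' (X0 Q3 y' - X1 Q3 y - X1 Q2 y1
    - X1 Q1 y2), which vanishes by the dynamics. *)
Lemma bform_Phi (T h : nat) (eps : R) (X0 X1 : 'M[R]_(n, T))
  P S (R1 R2 N1 N2 : 'M[R]_n)
  (Q1 Q2 Q3 : 'M[R]_(T, n)) (y y1 y2 yh y' : 'cV[R]_n) :
  R1^T = R1 -> R2^T = R2 ->
  X0 *m Q3 *m y' = X1 *m Q3 *m y + X1 *m Q2 *m y1 + X1 *m Q1 *m y2 ->
  let xi := col_mx y (col_mx y1 (col_mx y2 (col_mx yh y'))) in
  bform (Phi h eps X0 X1 P S R1 R2 N1 N2 Q1 Q2 Q3) xi xi =
  bform P y y - bform P y' y' - bform S y y + bform S yh yh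
  - h%:R ^+ 2 * bform (R1 + R2) (y' - y) (y' - y)
  + (bform R1 (y - y1) (y - y1) + 2 * bform N1 (y - y1) (y1 - yh)
     + bform R1 (y1 - yh) (y1 - yh))
  + (bform R2 (y - y2) (y - y2) + 2 * bform N2 (y - y2) (y2 - yh)
     + bform R2 (y2 - yh) (y2 - yh)).
Proof.
move=> R1sym R2sym dyn /=.
have bform1 N u v : bform N u v = bform 1%:M u (N *m v).
  by rewrite -bform_mulmx mul1mx.
have dyn1 u : bform (X0 *m Q3) u y' =
    bform (X1 *m Q3) u y + bform (X1 *m Q2) u y1 + bform (X1 *m Q1) u y2.
  by rewrite (bform1 (X0 *m Q3)) dyn !bformDr -!bform1.
rewrite /Phi -trmx_mul.
(* Once the products are generalized, the dynamics is a scalar identity between bilinear forms, used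
   only at [y] and [y']. *)
move: dyn1; move: (X0 *m Q3) (X1 *m Q1) (X1 *m Q2) (X1 *m Q3) => Z B1 B2 B3 dyn1.
rewrite !(bform_sym_block_mx, bform_row_mx).
rewrite !(bformDm, bformNm, bformZm, bform0m, bform_trmx).
rewrite !(bformDl, bformDr, bformNl, bformNr).
rewrite (bform_sym _ R1 y' y) // (bform_sym _ R1 y1 y) // (bform_sym _ R1 yh y1) //.
rewrite (bform_sym _ R2 y' y) // (bform_sym _ R2 y2 y) // (bform_sym _ R2 yh y2) //.
rewrite (dyn1 y) (dyn1 y'); ring.
Qed.

(** The form of [Phi] is the exact decrement with the sum of increments replaced by lower bounds. As
    the weight is [R1 + R2], that sum splits into one part for each delay. *)
Lemma lyapunov_decrease (T h : nat) (eps : R) (X0 X1 : 'M[R]_(n, T))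
  P S (R1 R2 N1 N2 : 'M[R]_n)
  (Q1 Q2 Q3 : 'M[R]_(T, n)) z k t1 t2 :
  posdef R1 -> posdef R2 ->
  possemidef (sym_block_mx R1 N1 R1) -> possemidef (sym_block_mx R2 N2 R2) ->
  (t1 <= h)%N -> (t2 <= h)%N ->
  X0 *m Q3 *m z (k + h).+1 = X1 *m Q3 *m z (k + h)%N
    + X1 *m Q2 *m z (k + h - t1)%N + X1 *m Q1 *m z (k + h - t2)%N ->
  let xi := col_mx (z (k + h)%N) (col_mx (z (k + h - t1)%N)
              (col_mx (z (k + h - t2)%N) (col_mx (z k) (z (k + h).+1)))) in
  bform (Phi h eps X0 X1 P S R1 R2 N1 N2 Q1 Q2 Q3) xi xi <=
  lyapunov h P S (R1 + R2) z k - lyapunov h P S (R1 + R2) z k.+1.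
Proof.
move=> R1pos R2pos RN1 RN2 t1h t2h dyn; have [R1s _] := R1pos; have [R2s _] := R2pos.
rewrite /= bform_Phi // lyapunov_step.
have := delay_sum_ge _ _ _ z k _ t1h R1pos RN1.
have := delay_sum_ge _ _ _ z k _ t2h R2pos RN2.
under [in X in _ -> _ -> X]eq_bigr do rewrite bformDm.
rewrite big_split /=; lra.
Qed.

Lemma bform_le_norm_unitmx M (Z : 'M[R]_n) : Z \in unitmx ->
  exists2 c : R, 0 <= c & forall v d, `|Z *m v| < d -> bform M v v <= c * d ^+ 2.
Proof.
move=> Zu; have [c c0 hc] := bform_le_norm _ ((invmx Z)^T *m M *m invmx Z).
exists c => // v d /hc; congr (_ <= _).
by rewrite /bform -!mulmxA mulKmx // !mulmxA -trmx_mul mulKmx.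
Qed.

Lemma lyapunov_history_le h P S M (Z : 'M[R]_n) : Z \in unitmx ->
  exists2 C : R, 0 <= C & forall z (d : R),
    (forall i, (i <= h)%N -> `|Z *m z i| < d) -> lyapunov h P S M z 0 <= C * d ^+ 2.
Proof.
move=> Zu.
have [cP cP0 hP] := bform_le_norm_unitmx P _ Zu.
have [cS cS0 hS] := bform_le_norm_unitmx S _ Zu.
have [cM cM0 hM] := bform_le_norm_unitmx M _ Zu.
exists (cP + \sum_(0 <= i < h) cS +
  h%:R * \sum_(0 <= i < h) (i.+1)%:R * (4 * cM)).
  rewrite !addr_ge0 ?mulr_ge0 ?sumr_ge0 // => i _; rewrite ?mulr_ge0 //.
move=> z d zd; rewrite /lyapunov 2!mulrDl -mulrA !mulr_suml.
apply: lerD; first apply: lerD.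
- by rewrite hP ?zd.
- by apply: ler_sum_nat => i /andP[_ ih]; rewrite hS ?zd // ltnW.
rewrite ler_wpM2l //; apply: ler_sum_nat => i /andP[_ ih].
rewrite add0n -mulrA ler_wpM2l //.
(* An increment is a difference of two history values, so its image under [Z] has norm below
   [d + d]; hence the factor 4. *)
have -> : 4 * cM * d ^+ 2 = cM * (d + d) ^+ 2 by ring.
apply: hM; rewrite mulmxBr; apply: (le_lt_trans (ler_normB _ _)).
by rewrite ltrD ?zd // ltnW.
Qed.

End LyapunovKrasovskii.

(** [W] is nonincreasing and bounded below, hence convergent, so its decrements tend to 0 and force
    the squared norms to 0. *)
Lemma cvg0_sq_le_decrement (R : realType) (V : normedModType R) (x : nat -> V)
    (W : nat -> R) (c : R) :
  0 < c -> (forall k, 0 <= W k) -> (forall k, `|x k| ^+ 2 <= c * (W k - W k.+1)) ->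
  (x @ \oo --> (0 : V))%classic.
Proof.
move=> c0 W0 xW.
have Wdec : {homo W : a b / (a <= b)%N >-> b <= a}.
  apply: homo_leq => [//|a b d ab bd|k]; first exact: le_trans bd ab.
  by rewrite -subr_ge0 -(pmulr_rge0 _ c0) (le_trans _ (xW k)) ?sqr_ge0.
have Wcvg : cvgn W.
  by apply: nonincreasing_is_cvgn => //; exists 0 => _ [k _ <-].
have dW : ((fun k => W k - W k.+1) @ \oo --> (0 : R))%classic.
  rewrite -(subrr (limn W)); apply: cvgB => //.
  by rewrite (cvg_shiftS W).
apply/cvgr0Pnorm_lt => e e0.
move/cvgr0Pnorm_lt : dW => /(_ (e ^+ 2 / c)).
rewrite divr_gt0 ?exprn_gt0 // => /(_ isT); apply: filterS => k hk.
rewrite -(ltr_pXn2r (n := 2)) ?nnegrE ?normr_ge0 ?(ltW e0) //.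
apply: (le_lt_trans (xW k)); rewrite mulrC -ltr_pdivlMr //.
exact: le_lt_trans (ler_norm _) hk.
Qed.

(** * From the recorded data to matrix identities *)

Section Data.
Context {R : realType}.

Lemma col_data_mx p (z : int -> 'cV[R]_p) s T (j : 'I_T) :
  col j (data_mx z s T) = z (s + j%:Z).
Proof. by apply/colP => i; rewrite !mxE. Qed.

Lemma data_mx_step n m T (A0 A1 : 'M[R]_n) (B : 'M[R]_(n, m)) d1 d2 ud xd :
  (forall k : nat, (k < T)%N -> delay_step A0 A1 B d1 d2 ud xd k) ->
  data_mx xd 1 T = A0 *m data_mx xd 0 T + A1 *m data_mx xd (- d1%:Z) T
                   + B *m data_mx ud (- d2%:Z) T.
Proof.
move=> data; apply/matrixP => i j.
suff /(congr1 (fun v : 'cV_n => v i 0)) :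
    col j (data_mx xd 1 T) = col j (A0 *m data_mx xd 0 T
      + A1 *m data_mx xd (- d1%:Z) T + B *m data_mx ud (- d2%:Z) T).
  by rewrite !mxE.
rewrite !linearD /= !(colE _ (_ *m _)) -!mulmxA -!colE !col_data_mx.
have := data j (ltn_ord j); rewrite /delay_step.
by rewrite add0r (addrC 1) !(addrC (- _)).
Qed.

End Data.

(** At (0, 0, 0, 0, v) only the last diagonal block of [Phi] survives. If v' X0 Q3 v were 0, its
    value would be - v' (P + hbar^2 (R1 + R2)) v, which is at most 0. *)
Lemma Phi_unitmx (R : realType) n T hbar (eps : R) (X0 X1 : 'M[R]_(n, T))
  (P S R1 R2 N1 N2 : 'M[R]_n) (Q1 Q2 Q3 : 'M[R]_(T, n)) :
  posdef P -> posdef R1 -> posdef R2 ->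
  posdef (Phi hbar eps X0 X1 P S R1 R2 N1 N2 Q1 Q2 Q3) -> X0 *m Q3 \in unitmx.
Proof.
move=> Ppos R1pos R2pos [_ Phipos]; apply: unitmx_bform => v v0; apply/eqP => Zv.
pose xi := col_mx (0 : 'cV[R]_n) (col_mx (0 : 'cV[R]_n)
  (col_mx (0 : 'cV[R]_n) (col_mx (0 : 'cV[R]_n) v))).
have xi0 : xi != 0.
  by apply: contra v0 => /eqP; rewrite /xi -!col_mx0 => /eq_col_mx[_] /eq_col_mx[_]
    /eq_col_mx[_] /eq_col_mx[_] ->.
have := Phipos _ xi0; rewrite -[X in 0 < X]/(bform _ _ _) /Phi -trmx_mul /xi.
rewrite !(bform_sym_block_mx, bform_row_mx, bform0l, bform0r).
rewrite !(bformDm, bformNm, bformZm, bform_trmx) Zv.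
have := posdef_ge0 _ _ v Ppos.
have : 0 <= hbar%:R ^+ 2 * (bform R1 v v + bform R2 v v).
  by rewrite mulr_ge0 ?exprn_ge0 // addr_ge0 ?posdef_ge0.
lra.
Qed.

(** * Stability and attractivity of the closed loop *)

Theorem theorem4p2 (R : realType) (n m T hbar : nat)
  (A0 A1 : 'M[R]_n) (B : 'M[R]_(n, m))
  (d1 d2 : nat) (ud : int -> 'cV[R]_m) (xd : int -> 'cV[R]_n)
  (hbar_gt0 : (0 < hbar)%N) (hbar_lt_T : (hbar < T)%N)
  (d1_le : (d1 <= hbar)%N) (d2_le : (d2 <= hbar)%N)
  (data : forall k : nat, (k < T)%N -> delay_step A0 A1 B d1 d2 ud xd k) :
  let U  := data_mx ud (- d2%:Z) T in
  let Xh := data_mx xd (- d1%:Z) T in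
  let X0 := data_mx xd 0 T in
  let X1 := data_mx xd 1 T in
  let W0 := col_mx U (col_mx Xh X0) in
  \rank W0 = (m + 2 * n)%N ->
  forall (eps : R), 0 < eps ->
  forall (P S R1 R2 S12_1 S12_2 : 'M[R]_n) (Q1 Q2 Q3 : 'M[R]_(T, n)),
  posdef P -> posdef S -> posdef R1 -> posdef R2 ->
  posdef (Phi hbar eps X0 X1 P S R1 R2 S12_1 S12_2 Q1 Q2 Q3) ->
  possemidef (sym_block_mx R1 S12_1 R1) ->
  possemidef (sym_block_mx R2 S12_2 R2) ->
  U *m Q2 = 0 -> U *m Q3 = 0 ->
  Xh *m Q1 = 0 -> Xh *m Q3 = 0 ->
  X0 *m Q1 = 0 -> X0 *m Q2 = 0 ->
  Xh *m Q2 = X0 *m Q3 ->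
  let K := U *m Q1 *m invmx (X0 *m Q3) in
  forall h1 h2 : nat -> nat,
  (forall k, (h1 k <= hbar)%N) -> (forall k, (h2 k <= hbar)%N) ->
  asymptotically_stable hbar (closed_loop A0 A1 B K h1 h2).
Proof.
move=> U Xh X0 X1 W0 _ eps eps0 P S R1 R2 N1 N2 Q1 Q2 Q3 Ppos Spos R1pos R2pos
  Phipos RN1 RN2 UQ2 UQ3 XhQ1 XhQ3 X0Q1 X0Q2 XhQ2 K h1 h2 h1_le h2_le.
have Zu : X0 *m Q3 \in unitmx by exact: Phi_unitmx Phipos.
have X1E := data_mx_step _ _ _ _ _ _ _ _ _ _ data.
rewrite -/X1 -/X0 -/Xh -/U in X1E.
pose Z := X0 *m Q3; rewrite -/Z in Zu.
have X1Q3 : X1 *m Q3 = A0 *m Z.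
  by rewrite X1E !mulmxDl -!mulmxA XhQ3 UQ3 !mulmx0 !addr0.
have X1Q2 : X1 *m Q2 = A1 *m Z.
  by rewrite X1E !mulmxDl -!mulmxA X0Q2 UQ2 XhQ2 !mulmx0 addr0 add0r.
have X1Q1 : X1 *m Q1 = B *m K *m Z.
  rewrite X1E !mulmxDl -!mulmxA X0Q1 XhQ1 !mulmx0 !add0r.
  by rewrite mulVmx ?mulmx1.
have Mpos := posdefD _ _ _ R1pos R2pos.
(* The shift by [hbar] puts the whole history at natural indices: [z x k] is the transformed state
   at time [k - hbar]. *)
pose z (x : int -> 'cV[R]_n) k := invmx Z *m x (k%:Z - hbar%:Z).
have Zz x k : Z *m z x k = x (k%:Z - hbar%:Z) by rewrite /z mulKVmx.
have Zzk x k : Z *m z x (k + hbar)%N = x k%:Z.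
  by rewrite Zz; congr x; lia.
pose V x k := lyapunov hbar P S (R1 + R2) (z x) k.
pose xi x k := col_mx (z x (k + hbar)%N) (col_mx (z x (k + hbar - h1 k)%N)
  (col_mx (z x (k + hbar - h2 k)%N) (col_mx (z x k) (z x (k + hbar).+1)))).
have Vdec x k : closed_loop A0 A1 B K h1 h2 x ->
    bform (Phi hbar eps X0 X1 P S R1 R2 N1 N2 Q1 Q2 Q3) (xi x k) (xi x k)
    <= V x k - V x k.+1.
  move=> clx; apply: lyapunov_decrease => //.
  rewrite X1Q3 X1Q2 X1Q1 -/Z.
  rewrite -(mulmxA A0) -(mulmxA A1) -(mulmxA (B *m K)) !Zz -(mulmxA B).
  have := clx k; rewrite /delay_step.
  have -> : (k + hbar).+1%:Z - hbar%:Z = k%:Z + 1 by lia.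
  have -> : (k + hbar)%N%:Z - hbar%:Z = k%:Z by lia.
  (* The truncated subtraction is exact because the delay is at most [hbar]. *)
  have -> : (k + hbar - h1 k)%N%:Z - hbar%:Z = k%:Z - (h1 k)%:Z.
    by have := h1_le k; lia.
  have -> // : (k + hbar - h2 k)%N%:Z - hbar%:Z = k%:Z - (h2 k)%:Z.
  by have := h2_le k; lia.
have V_ge x k : bform P (z x (k + hbar)%N) (z x (k + hbar)%N) <= V x k.
  exact: lyapunov_ge.
have V_ge0 x k : 0 <= V x k by rewrite (le_trans _ (V_ge x k)) ?posdef_ge0.
have V_le x k : closed_loop A0 A1 B K h1 h2 x -> V x k <= V x 0%N.
  move=> clx; elim: k => // k; apply: le_trans.
  by rewrite -subr_ge0 (le_trans _ (Vdec x k clx)) ?posdef_ge0.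
split.
  move=> e e0; have [c c0 xP] := posdef_norm_le _ _ _ Z Ppos.
  have [C C0 VC] := lyapunov_history_le hbar P S (R1 + R2) _ Zu.
  (* For d = e / sqrt a, the bound c C d^2 equals e^2 C / (C + 1), strictly below e^2 even when [C]
     is 0. *)
  pose a := c * (C + 1); have a0 : 0 < a by rewrite mulr_gt0 ?ltr_wpDl.
  exists (e / Num.sqrt a); first by rewrite divr_gt0 ?sqrtr_gt0.
  move=> x clx hx k.
  rewrite -(ltr_pXn2r (n := 2)) ?nnegrE ?normr_ge0 ?(ltW e0) // -Zzk.
  apply: (le_lt_trans (xP _)).
  have {}VC : V x 0%N <= C * (e / Num.sqrt a) ^+ 2.
    by apply: VC => i ih; rewrite Zz; apply: hx; lia.
  apply: (@le_lt_trans _ _ (c * (C * (e / Num.sqrt a) ^+ 2))).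
    by rewrite ler_wpM2l ?(ltW c0) // (le_trans (V_ge x k)) // (le_trans (V_le x k clx)).
  rewrite expr_div_n sqr_sqrtr ?(ltW a0) // mulrA mulrCA gtr_pMr ?exprn_gt0 //.
  by rewrite ltr_pdivrMr // mul1r /a ltr_pM2l // ltrDl.
(* Attraction is global, so any radius serves. *)
exists 1 => // x clx _.
(* [row_mx Z 0] extracts [x k] from [xi x k], so the form of [Phi], and with it the decrement of
   [V], dominates the squared norm of the state. *)
have [c c0 xPhi] := posdef_norm_le _ _ _ (row_mx Z 0) Phipos.
apply: (cvg0_sq_le_decrement _ _ _ (V x) c) => // k.
have := xPhi (xi x k); rewrite mul_row_col mul0mx addr0 Zzk => /le_trans; apply.
by rewrite ler_wpM2l ?(ltW c0) // Vdec.
Qed.
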